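(* The eigenvalue map $\lambda:\mathbb{P}_n\to\mathbb{R}_+^n$ is $\delta$-contractive: $$\delta(\lambda(A),\lambda(B))\le\delta(A,B),\qquad A,B\in\mathbb{P}_n.$$ Moreover, $\delta^W(\lambda_*\mu,\lambda_*\nu)\le\delta^W(\mu,\nu)$ for $\mu,\nu\in\mathcal{P}^1(\mathbb{P}_n)$.
   Context: $\mathbb{P}_n$ is the set of $n\times n$ real symmetric positive definite matrices with Riemannian distance $\delta(A,B)=\|\log A^{-1/2}BA^{-1/2}\|_2$, where $\|X\|_2=(\operatorname{tr}X^2)^{1/2}$. $\mathbb{R}_+=(0,\infty)$, and $\mathbb{R}_+^n$ is identified with the diagonal matrices in $\mathbb{P}_n$, so $\delta(a,b)=\|\log a-\log b\|_2$ for $a,b\in\mathbb{R}_+^n$ (componentwise logarithm, Euclidean norm). $\lambda(A)=(\lambda_1(A),\dots,\lambda_n(A))$ is the vector of eigenvalues of $A$ in decreasing order, counted with multiplicity. For $X=\mathbb{P}_n$ or $\mathbb{R}_+^n$, $\mathcal{P}^1(X)$ is the set of Borel probability measures $\mu$ on $X$ with $\int_X\delta(a,x)\,d\mu(a)<\infty$ for some $x\in X$, and the Wasserstein metric on $\mathcal{P}^1(X)$ is $\delta^W(\mu,\nu)=\inf_{\pi\in\Pi(\mu,\nu)}\int_{X\times X}\delta(x,y)\,d\pi(x,y)$, where $\Pi(\mu,\nu)$ is the set of couplings of $\mu$ and $\nu$. $\lambda_*\mu$ denotes the push-forward of $\mu$ by $\lambda$. *)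

(* Defs.v *)
From HB Require Import structures.
From mathcomp Require Import all_boot all_order all_algebra.
From mathcomp Require Import complex.
From mathcomp Require Import all_classical all_reals all_analysis.

Set Implicit Arguments.
Unset Strict Implicit.
Unset Printing Implicit Defensive.

Import Order.TTheory GRing.Theory Num.Theory.
Import numFieldNormedType.Exports.

Local Open Scope classical_set_scope.
Local Open Scope ring_scope.

Section MatrixFunctions.
Variables (R : realType) (n : nat).
Implicit Types A B : 'M[R]_n.

(* [f(A) = P^-1 diag(f(d_1), ..., f(d_n)) P] whenever [A = P^-1 diag(d) P];
   independent of the diagonalization by [mxfun_diag], and every real symmetric
   [A] has one by [symmetric_diagonalizable]. The default value [0] is only
   reached on matrices that are not diagonalizable over [R]. *)
Definition mxfun (f : R -> R) A : 'M[R]_n :=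
  xget 0 [set B | exists P : 'M[R]_n, exists d : 'rV[R]_n,
    [/\ P \in unitmx, A = invmx P *m diag_mx d *m P
      & B = invmx P *m diag_mx (map_mx f d) *m P]].

Definition mxlog A : 'M[R]_n := mxfun (@ln R) A.

Definition mxpow (r : R) A : 'M[R]_n := mxfun (fun x => x `^ r) A.

Definition norm2 A : R := Num.sqrt (\tr (A *m A)).

Definition posdefmx : set 'M[R]_n :=
  [set A | A^T = A /\
     forall u : 'rV[R]_n, u != 0 -> 0 < (u *m A *m u^T) 0 0].

Definition posvec : set 'rV[R]_n := [set a | forall i, 0 < a 0 i].

Lemma mxfun_diag (f : R -> R) (P : 'M[R]_n) (d : 'rV[R]_n) :
  P \in unitmx ->
  mxfun f (invmx P *m diag_mx d *m P) = invmx P *m diag_mx (map_mx f d) *m P.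
Proof.
move=> Pu; rewrite /mxfun; apply: xget_unique; first by exists P, d.
move=> B [Q [e [Qu eqA ->]]].
have comm : forall g : R -> R, diag_mx (map_mx g d) *m (P *m invmx Q) =
    (P *m invmx Q) *m diag_mx (map_mx g e) ->
    invmx Q *m diag_mx (map_mx g e) *m Q = invmx P *m diag_mx (map_mx g d) *m P.
  move=> g h; have := congr1 (fun M => invmx P *m M *m Q) h.
  by rewrite !mulmxA mulVmx// mul1mx -!mulmxA mulVmx// mulmx1 !mulmxA => ->.
apply: comm.
have : diag_mx d *m (P *m invmx Q) = (P *m invmx Q) *m diag_mx e.
  have := congr1 (fun M => P *m M *m invmx Q) eqA.
  by rewrite !mulmxA mulmxV// mul1mx -!mulmxA mulmxV// mulmx1 !mulmxA.
move: (P *m invmx Q) => S /matrixP h; apply/matrixP => i j.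
have := h i j; rewrite !mul_diag_mx !mul_mx_diag !mxE => hij.
have [->|S0] := eqVneq (S i j) 0; first by rewrite mulr0 mul0r.
by rewrite [RHS]mulrC; congr (f _ * _); apply: (mulIf S0); rewrite hij mulrC.
Qed.

Lemma symmetric_diagonalizable A : A^T = A ->
  exists P : 'M[R]_n, exists2 d : 'rV[R]_n,
    P \in unitmx & A = invmx P *m diag_mx d *m P.
Proof.
move=> symA; pose C := map_mx (real_complex R) A : 'M[R[i]]_n.
have Creal : C \is a mxOver Num.real.
  by apply/mxOverP => i j; rewrite mxE; apply/complex_realP; exists (A i j).
have symC : C \is symmetricmx.
  apply/is_hermitianmxP; rewrite expr0 scale1r map_mx_id//.
  by apply/matrixP => i j; rewrite !mxE -[in LHS]symA mxE.
have hC := realsym_hermsym symC Creal.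
have /orthomx_spectralP eqC := hermitian_normalmx hC.
have dreal := hermitian_spectral_diag_real hC.
have sim : similar_in unitmx C (diag_mx (spectral_diag C)).
  exists (spectralmx C); first exact: spectral_unit.
  apply/(simmxP (spectral_unit _)).
  have := congr1 (mulmx (spectralmx C)) eqC.
  by rewrite !mulmxA mulmxV ?spectral_unit// mul1mx.
have realD : diag_mx (spectral_diag C) \is a mxOver Num.real.
  apply/mxOverP => i j; rewrite mxE; apply: rpredMn; have /mxOverP := dreal; exact.
have [Q /= /andP[Qreal Qu] /(simmxP Qu) QC] := real_similar sim Creal realD.
pose P : 'M[R]_n := map_mx (@complex.Re R) Q.
pose d : 'rV[R]_n := map_mx (@complex.Re R) (spectral_diag C).
have eqQ : Q = map_mx (real_complex R) P.
  by apply/matrixP => i j; rewrite !mxE; have /mxOverP/(_ i j)/complex_realP[k ->] := Qreal.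
have eqd : spectral_diag C = map_mx (real_complex R) d.
  by apply/matrixP => i j; rewrite !mxE; have /mxOverP/(_ i j)/complex_realP[k ->] := dreal.
have Pu : P \in unitmx by rewrite -(map_unitmx (real_complex R)) -eqQ.
exists P, d => //.
have : P *m A = diag_mx d *m P.
  apply: (@map_mx_inj _ _ (real_complex R)).
  by rewrite !map_mxM/= map_diag_mx -eqQ -eqd.
by move=> PA; rewrite -mulmxA -PA mulmxA mulVmx// mul1mx.
Qed.

Lemma posdefmx1 : posdefmx 1%:M.
Proof.
split=> [|u u0]; first exact: trmx1.
rewrite mulmx1 mxE; rewrite lt_def; apply/andP; split; last first.
  by apply: sumr_ge0 => i _; rewrite mxE -expr2 sqr_ge0.
rewrite psumr_neq0; last by move=> i _; rewrite mxE -expr2 sqr_ge0.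
have [i ui] : exists i, u 0 i != 0.
  by apply/existsP; apply: contraNT u0; rewrite negb_exists => /forallP u0;
    apply/eqP/rowP => i; rewrite mxE; apply/eqP; rewrite -[_ == _]negbK.
by apply/hasP; exists i; rewrite ?mem_index_enum//= mxE -expr2 exprn_even_gt0.
Qed.

Lemma posvec1 : posvec (const_mx 1).
Proof. by move=> i; rewrite mxE ltr01. Qed.

Lemma posdefmx_eigenvalues A : posdefmx A ->
  exists a : 'rV[R]_n, [/\ posvec a,
    forall i j : 'I_n, (i <= j)%N -> a 0 j <= a 0 i &
    char_poly A = \prod_(i < n) ('X - (a 0 i)%:P)].
Proof.
move=> [symA posA]; have [P [d Pu eqA]] := symmetric_diagonalizable symA.
have dpos i : 0 < d 0 i.
  pose u := row i P.
  have u0 : u != 0.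
    apply: contraTneq Pu => u0; rewrite -row_free_unit -kermx_eq0.
    apply/negP => /eqP kP0.
    have : (delta_mx 0 i : 'rV[R]_n) *m P = 0 by rewrite -rowE.
    move=> /sub_kermxP; rewrite kP0 submx0 => /eqP/rowP/(_ i)/eqP.
    by rewrite !mxE !eqxx/= oner_eq0.
  have uA : u *m A = d 0 i *: u.
    rewrite /u eqA rowE !mulmxA -[_ *m P *m _]mulmxA mulmxV// mulmx1.
    by rewrite -rowE row_diag_mx -scalemxAl.
  have := posA u u0; rewrite uA -scalemxAl mxE.
  have /posdefmx1.2 := u0; rewrite mulmx1 => uu.
  by rewrite pmulr_lgt0.
have chA : char_poly A = \prod_(x <- [seq d 0 i | i : 'I_n]) ('X - x%:P).
  have detP : \det (map_mx polyC (invmx P)) * \det (map_mx polyC P) = 1 :> {poly R}.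
    by rewrite -det_mulmx -map_mxM mulVmx// map_mx1 det1.
  have -> : char_poly A = char_poly (diag_mx d).
    rewrite /char_poly -[RHS]mul1r -detP mulrAC -!det_mulmx; congr (\det _).
    rewrite /char_poly_mx mulmxBr mulmxBl -!map_mxM eqA; congr (_ - _).
    by rewrite mul_mx_scalar -scalemxAl -map_mxM mulVmx// map_mx1 scalemx1.
  rewrite char_poly_trig ?diag_mx_is_trig// big_map big_enum/=.
  by apply: eq_bigr => i _; rewrite mxE eqxx mulr1n.
pose s := sort >=%R [seq d 0 i | i : 'I_n].
have szs : size s = n by rewrite size_sort size_map size_enum_ord.
have sorts : sorted >=%R s by apply: sort_sorted => x y; exact: le_total.
exists (\row_i s`_i); split.
- move=> i; rewrite mxE; have : s`_i \in s by rewrite mem_nth ?szs.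
  by rewrite mem_sort => /mapP[j _ ->].
- move=> i j ij; rewrite !mxE.
  apply: (sorted_leq_nth _ _ _ sorts) => //; rewrite ?inE ?szs//.
  by move=> y x z yx zy; exact: le_trans zy yx.
  exact: lexx.
- rewrite chA (perm_big s)/=; last by rewrite perm_sym; exact/permPl/perm_sort.
  by rewrite (big_nth 0) szs big_mkord; apply: eq_bigr => i _; rewrite mxE.
Qed.

End MatrixFunctions.

(* The topology, hence the Borel sigma-algebra, of a metric space. *)
Definition dist_open (R : realType) (T : Type) (d : T -> T -> R) :
    set (set T) :=
  [set U | forall x, U x -> nbhs_ball_ (fun y e => [set z | d y z < e]) x U].

Definition Pn (R : realType) (n : nat) : Type := set_type (@posdefmx R n).

Definition Rpos (R : realType) (n : nat) : Type := set_type (@posvec R n).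

Section EigenvalueMap.
Variables (R : realType) (n : nat).

HB.instance Definition _ := Choice.on (Pn R n).
HB.instance Definition _ := isPointed.Build (Pn R n)
  (exist _ 1%:M (mem_set (@posdefmx1 R n)) : Pn R n).

HB.instance Definition _ := Choice.on (Rpos R n).
HB.instance Definition _ := isPointed.Build (Rpos R n)
  (exist _ (const_mx 1) (mem_set (@posvec1 R n)) : Rpos R n).

Definition delta (A B : Pn R n) : R :=
  let S := mxpow (- 2^-1) (val A) in norm2 (mxlog (S *m val B *m S)).

Definition deltapos (a b : Rpos R n) : R :=
  Num.sqrt (\sum_(i < n) (ln (val a 0 i) - ln (val b 0 i)) ^+ 2).

HB.instance Definition _ := Measurable.copy (Pn R n)
  (g_sigma_algebraType (dist_open delta)).
HB.instance Definition _ := Measurable.copy (Rpos R n)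
  (g_sigma_algebraType (dist_open deltapos)).

(* The factorization of the characteristic polynomial records multiplicities. *)
Definition is_eigenvalues (A : Pn R n) (a : Rpos R n) : Prop :=
  (forall i j : 'I_n, (i <= j)%N -> val a 0 j <= val a 0 i) /\
  char_poly (val A) = \prod_(i < n) ('X - (val a 0 i)%:P).

Lemma eigenvalues_exist (A : Pn R n) : exists a, is_eigenvalues A a.
Proof.
have [a [pa ha eqa]] := posdefmx_eigenvalues (set_mem (valP A)).
by exists (exist _ a (mem_set pa)).
Qed.

Definition lambda (A : Pn R n) : Rpos R n := projT1 (cid (eigenvalues_exist A)).

Lemma lambdaP (A : Pn R n) : is_eigenvalues A (lambda A).
Proof. exact: projT2 (cid (eigenvalues_exist A)). Qed.

Lemma is_eigenvalues_unique (A : Pn R n) (a : Rpos R n) :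
  is_eigenvalues A a -> a = lambda A.
Proof.
have [le_l eq_l] := lambdaP A; move=> [le_a eq_a].
have srt (b : Rpos R n) :
    (forall i j : 'I_n, (i <= j)%N -> val b 0 j <= val b 0 i) ->
    sorted >=%R [seq val b 0 i | i : 'I_n].
  move=> le_b; apply/(sortedP 0) => k; rewrite size_map size_enum_ord => kn.
  have kn1 := ltnW kn.
  have nthE m : (m < n)%N -> [seq val b 0 i | i : 'I_n]`_m =
      val b 0 (nth (Ordinal kn) (enum 'I_n) m).
    by move=> mn; rewrite (nth_map (Ordinal kn)) ?size_enum_ord.
  by rewrite !nthE//; apply: le_b; rewrite !nth_enum_ord.
have prm : perm_eq [seq val a 0 i | i : 'I_n] [seq val (lambda A) 0 i | i : 'I_n].
  apply: prod_XsubC_eq; rewrite [LHS]big_map [RHS]big_map !big_enum/=.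
  by rewrite -eq_a -eq_l.
have trans : transitive (>=%R : rel R) by move=> y x z yx zy; exact: le_trans zy yx.
have anti : antisymmetric (>=%R : rel R).
  by move=> x y; rewrite andbC => /le_anti.
have := sorted_eq trans anti (srt _ le_a) (srt _ le_l) prm.
move=> /eq_in_map eqal; apply: val_inj; apply/rowP => i.
by apply: eqal; rewrite mem_enum.
Qed.

End EigenvalueMap.

Section Wasserstein.
Local Open Scope ereal_scope.
Context (disp : measure_display) (T : measurableType disp) (R : realType).
Variable d : T -> T -> R.

Definition finite_moment (mu : set T -> \bar R) : Prop :=
  exists x, \int[mu]_a (d a x)%:E < +oo.

(* On a separable metric space the product sigma-algebra carried by [T * T] is
   the Borel sigma-algebra of the product. *)
Definition coupling (mu nu : set T -> \bar R) :
    set (probability (T * T)%type R) :=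
  [set pi | forall U, measurable U ->
    pushforward pi fst U = mu U /\ pushforward pi snd U = nu U].

Definition wasserstein (mu nu : set T -> \bar R) : \bar R :=
  ereal_inf [set \int[pi]_z (d z.1 z.2)%:E | pi in coupling mu nu].

End Wasserstein.

(* Main.v *)
(* Write [a], [b] for the decreasing eigenvalue vectors of [A], [B], and [d] for
   the eigenvalues of [A^(-1/2) B A^(-1/2)]. Fiedler's inequality
   [\prod_i (a_i + t b_i) <= \det (A + t B)], divided by [\det A], gives
   [\prod_i (1 + t b_i / a_i) <= \prod_i (1 + t d_i)] for every [t > 0], while both
   products of ratios agree: [\prod_i (b_i / a_i) = \prod_i d_i]. Since
   [x |-> x ^ 2] is, up to affine terms, a mixture of the translates of
   [x |-> ln (1 + expR x)], taking logarithms and integrating over [ln t] yields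
   [\sum_i ln (b_i / a_i) ^ 2 <= \sum_i ln d_i ^ 2], which is the contraction.
   Fiedler's inequality follows by AM-GM from
   [n = \tr ((A + B) C^-1) >= \sum_i (a_i + b_i) / c_i], where [C = A + B] has
   eigenvalues [c]: traces of products are smallest for oppositely ordered spectra.
   For the Wasserstein distances, push couplings forward along
   [(x, y) |-> (lambda x, lambda y)]. *)
Require Import Defs.
From HB Require Import structures.
From mathcomp Require Import all_boot all_order all_algebra all_fingroup.
From mathcomp Require Import all_classical all_reals all_analysis.
From mathcomp Require Import measurable_realfun ring lra.

Set Implicit Arguments.
Unset Strict Implicit.
Unset Printing Implicit Defensive.

Import Order.TTheory GRing.Theory Num.Theory.
Import numFieldNormedType.Exports.

Local Open Scope classical_set_scope.
Local Open Scope ring_scope.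

(** * Orthogonal diagonalization with decreasing eigenvalues *)

Section SpectralTheorem.
Variables (R : realType) (n : nat).
Implicit Types A X : 'M[R]_n.

(** In a basis diagonalizing [A], commuting with [diag_mx d] forces the [(i, j)] entry to vanish
    unless [d_i = d_j], and then [f d_i = f d_j] as well. *)
Lemma mxfun_comm (f : R -> R) A X : A^T = A -> X *m A = A *m X ->
  X *m mxfun f A = mxfun f A *m X.
Proof.
move=> /symmetric_diagonalizable[P [d Pu ->]] cX; rewrite mxfun_diag//.
have cY : (P *m X *m invmx P) *m diag_mx d = diag_mx d *m (P *m X *m invmx P).
  have := congr1 (fun M => P *m M *m invmx P) cX.
  by rewrite !mulmxA mulmxV// mul1mx -!mulmxA mulmxV// mulmx1 !mulmxA.
have {cY} : (P *m X *m invmx P) *m diag_mx (map_mx f d) =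
    diag_mx (map_mx f d) *m (P *m X *m invmx P).
  move: (P *m X *m invmx P) cY => Y /matrixP cY; apply/matrixP => i j.
  have := cY i j; rewrite !mul_diag_mx !mul_mx_diag !mxE => e.
  have [->|Y0] := eqVneq (Y i j) 0; first by rewrite mulr0 mul0r.
  by rewrite [RHS]mulrC; congr (_ * f _); apply: (mulfI Y0); rewrite e mulrC.
move=> /(congr1 (fun M => invmx P *m M *m P)).
by rewrite !mulmxA mulVmx// mul1mx -!mulmxA mulVmx// mulmx1 !mulmxA.
Qed.

(** Transposing a diagonalization by [P] gives one by [(invmx P)^T] with the same [d], and [mxfun]
    does not depend on the diagonalization. *)
Lemma mxfun_tr (f : R -> R) A : A^T = A -> (mxfun f A)^T = mxfun f A.
Proof.
move=> symA; have [P [d Pu eA]] := symmetric_diagonalizable symA.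
have invE : P^T = invmx (invmx P)^T by rewrite -trmx_inv invmxK.
rewrite -[in RHS]symA eA mxfun_diag// !trmx_mul !tr_diag_mx !mulmxA invE mxfun_diag//.
by rewrite unitmx_tr unitmx_inv.
Qed.

Lemma posdef_diag_gt0 A (P : 'M[R]_n) (d : 'rV[R]_n) : posdefmx A ->
  P \in unitmx -> A = invmx P *m diag_mx d *m P -> forall i, 0 < d 0 i.
Proof.
move=> [_ posA] Pu eqA i; pose u := row i P.
have u0 : u != 0.
  apply/eqP => /(congr1 (mulmx^~ (invmx P))); rewrite -row_mul mulmxV// mul0mx.
  by move=> /rowP/(_ i)/eqP; rewrite !mxE eqxx oner_eq0.
have uA : u *m A = d 0 i *: u.
  rewrite /u eqA rowE !mulmxA -[_ *m P *m _]mulmxA mulmxV// mulmx1.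
  by rewrite -rowE row_diag_mx -scalemxAl.
have := posA u u0; rewrite uA -scalemxAl mxE.
by have := (posdefmx1 R n).2 u u0; rewrite mulmx1 => uu; rewrite pmulr_lgt0.
Qed.

Lemma mulmx_invsqrt A (S := mxpow (- 2^-1) A) : posdefmx A ->
  S *m A *m S = 1%:M.
Proof.
move=> posA; have [P [d Pu eA]] := symmetric_diagonalizable posA.1.
have d0 := posdef_diag_gt0 posA Pu eA.
have mulconj (D E : 'M[R]_n) :
    (invmx P *m D *m P) *m (invmx P *m E *m P) = invmx P *m (D *m E) *m P.
  by rewrite !mulmxA -[_ *m P *m invmx P]mulmxA mulmxV// mulmx1.
rewrite /S eA /mxpow mxfun_diag// !mulconj.
have -> : diag_mx (map_mx (fun x => x `^ (- 2^-1)) d) *m diag_mx d *m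
    diag_mx (map_mx (fun x => x `^ (- 2^-1)) d) = 1%:M.
  apply/matrixP => i j; rewrite mul_mx_diag mul_diag_mx !mxE.
  have [->|] := eqVneq i j; last by rewrite mulr0n mulr0 mul0r.
  rewrite !mulr1n mulrAC -powRD; last by apply/implyP => _; rewrite gt_eqF.
  rewrite -opprD (_ : 2^-1 + 2^-1 = 1); last by field.
  by rewrite powRN powRr1 ?ltW// mulVf// gt_eqF.
by rewrite mulmx1 mulVmx.
Qed.

(* If [P *m A = diag_mx d *m P] then [G := P *m P^T] commutes with [diag_mx d],
   hence so does [G^(-1/2)], and [G^(-1/2) *m P] is orthogonal. *)
Lemma symmetric_orthodiag A : A^T = A -> exists U : 'M[R]_n, exists d : 'rV[R]_n,
  U *m U^T = 1%:M /\ A = U^T *m diag_mx d *m U.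
Proof.
move=> symA; have [P [d Pu eA]] := symmetric_diagonalizable symA.
have PA : P *m A = diag_mx d *m P by rewrite eA !mulmxA mulmxV// mul1mx.
pose G := P *m P^T.
have posG : posdefmx G.
  split=> [|u u0]; first by rewrite trmx_mul trmxK.
  have := (posdefmx1 R n).2 (u *m P); rewrite mulmx1 trmx_mul !mulmxA; apply.
  apply: contra_neq u0 => /(congr1 (mulmx^~ (invmx P))).
  by rewrite -mulmxA mulmxV// mulmx1 mul0mx.
pose S := mxpow (- 2^-1) G.
have SGS : S *m G *m S = 1%:M by exact: mulmx_invsqrt.
have symS : S^T = S by apply: mxfun_tr; exact: posG.1.
(* Both sides equal [P *m A *m P^T], by the symmetry of [A]. *)
have GD : diag_mx d *m G = G *m diag_mx d.
  by rewrite mulmxA -PA -[in LHS]symA -!mulmxA -trmx_mul PA trmx_mul tr_diag_mx.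
have SD : diag_mx d *m S = S *m diag_mx d by apply: mxfun_comm; first exact: posG.1.
have UU : (S *m P) *m (S *m P)^T = 1%:M
  by rewrite trmx_mul symS !mulmxA -[S *m P *m _]mulmxA.
exists (S *m P), d; split => //.
have UA : (S *m P) *m A = diag_mx d *m (S *m P) by rewrite -mulmxA PA !mulmxA SD.
by rewrite -mulmxA -UA mulmxA (mulmx1C UU) mul1mx.
Qed.

Lemma posdef_orthodiag A : posdefmx A -> exists U : 'M[R]_n, exists a : 'rV[R]_n,
  [/\ U *m U^T = 1%:M, A = U^T *m diag_mx a *m U, posvec a &
      forall i j : 'I_n, (i <= j)%N -> a 0 j <= a 0 i].
Proof.
move=> posA; have [U [d [UU eA]]] := symmetric_orthodiag posA.1.
have Uu : U \in unitmx by have [] := mulmx1_unit UU.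
have invU : invmx U = U^T by rewrite -[LHS]mulmx1 -UU mulKmx.
have d0 : posvec d by apply: (posdef_diag_gt0 posA Uu); rewrite invU.
(* Sorting the entries as a tuple yields the permutation [p] behind the reordering, which the
   orthogonal factor [perm_mx p *m U] absorbs. *)
pose t := [tuple d 0 i | i < n].
pose s := sort >=%R t.
have szs : size s = n by rewrite size_sort size_tuple.
have sorts : sorted >=%R s by apply: sort_sorted => x y; exact: le_total.
have [p ep] : exists p : 'S_n, s = [tuple tnth t (p i) | i < n].
  by apply/tuple_permP; exact/permPl/perm_sort.
have es (i : 'I_n) : s`_i = d 0 (p i).
  by rewrite ep -[X in X`_i]/(tval _) -tnth_nth !tnth_mktuple.
exists (perm_mx p *m U), (\row_i d 0 (p i)); split.
- rewrite trmx_mul mulmxA -[_ *m U *m _]mulmxA UU mulmx1.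
  by rewrite tr_perm_mx -perm_mxM mulgV perm_mx1.
- have -> : diag_mx (\row_i d 0 (p i)) = perm_mx p *m diag_mx d *m (perm_mx p)^T.
    rewrite tr_perm_mx -row_permE -col_permE; apply/matrixP => i j.
    by rewrite !mxE (inj_eq perm_inj).
  have PP : (perm_mx p)^T *m perm_mx p = 1%:M :> 'M[R]_n.
    by rewrite tr_perm_mx -perm_mxM mulVg perm_mx1.
  by rewrite trmx_mul !mulmxA -[_ *m _^T *m perm_mx p]mulmxA PP mulmx1
    -[_ *m _^T *m perm_mx p]mulmxA PP mulmx1.
- by move=> i; rewrite mxE.
- move=> i j ij; rewrite !mxE -!es.
  apply: (sorted_leq_nth _ _ _ sorts) => //; rewrite ?inE ?szs//.
    by move=> y x z yx zy; exact: le_trans zy yx.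
  exact: lexx.
Qed.

Lemma char_poly_orthodiag (U : 'M[R]_n) (a : 'rV[R]_n) : U *m U^T = 1%:M ->
  char_poly (U^T *m diag_mx a *m U) = \prod_(i < n) ('X - (a 0 i)%:P).
Proof.
move=> UU.
have UUp : map_mx polyC U^T *m map_mx polyC U = 1%:M :> 'M[{poly R}]_n.
  by rewrite -map_mxM (mulmx1C UU) map_mx1.
have detU : \det (map_mx polyC U^T) * \det (map_mx polyC U) = 1 :> {poly R}.
  by rewrite -det_mulmx UUp det1.
have -> : char_poly (U^T *m diag_mx a *m U) = char_poly (diag_mx a).
  rewrite /char_poly -[RHS]mul1r -detU mulrAC -!det_mulmx; congr (\det _).
  rewrite /char_poly_mx mulmxBr mulmxBl !map_mxM; congr (_ - _).
  by rewrite mul_mx_scalar -scalemxAl UUp scalemx1.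
rewrite char_poly_trig ?diag_mx_is_trig//.
by apply: eq_bigr => i _; rewrite mxE eqxx mulr1n.
Qed.

(** [lambda] is specified only through the characteristic polynomial; uniqueness of the sorted roots
    identifies it with the diagonal found above. *)
Lemma lambda_orthodiag (A : Pn R n) : exists2 U : 'M[R]_n,
  U *m U^T = 1%:M & val A = U^T *m diag_mx (val (lambda A)) *m U.
Proof.
have [U [a [UU eA a0 sa]]] := posdef_orthodiag (set_mem (valP A)).
have <- : (exist _ a (mem_set a0) : Rpos R n) = lambda A; last by exists U.
by apply: is_eigenvalues_unique; split=> //; rewrite eA char_poly_orthodiag.
Qed.

End SpectralTheorem.

(** * From products at every [t] to sums of squared logarithms *)

Section LogSumInequality.
Variable R : realType.

(** A half-line is enough: only bounded windows are used later, and [a] can be put to their left.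
    Integrability up to [x + 1] makes [x] an interior point. *)
Lemma continuous_antiderivative (f : R -> R) (a : R) : continuous f ->
  exists F : R -> R, forall x, a < x -> is_derive x 1 F (f x).
Proof.
move=> cf; exists (fun x => \int[lebesgue_measure]_(t in `[a, x]) f t)%R => x ax.
have xu : x < x + 1 by rewrite ltrDl.
have intf : lebesgue_measure.-integrable `[a, x + 1] (EFin \o f).
  apply: continuous_compact_integrable; first exact: segment_compact.
  by apply: continuous_subspaceT => y; exact: cf.
have [dF eF] := continuous_FTC1_closed xu intf ax (cf x).
by rewrite -eF derive1E; exact: derivableP.
Qed.

(** At [u = ln z + s] with [t = expR s] this is [ln (1 + t * z)]: the parameter [t] becomes a
    translation. *)
Definition softplus (u : R) : R := ln (1 + expR u).

Lemma continuous_softplus : continuous softplus.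
Proof.
move=> u; apply: (@continuous_comp _ _ _ (fun v => 1 + expR v)).
  by apply: continuousD; [exact: cvg_cst|exact: continuous_expR].
by apply: continuous_ln; rewrite addr_gt0// expR_gt0.
Qed.

Lemma softplus_ge0 u : 0 <= softplus u.
Proof. by rewrite ln_ge0// lerDl expR_ge0. Qed.

Lemma softplus_le_expR u : softplus u <= expR u.
Proof. by apply: le_ln1Dx; rewrite (lt_le_trans _ (expR_ge0 u))// ltrN10. Qed.

Lemma softplusN u : softplus u = u + softplus (- u).
Proof.
rewrite /softplus -{2}[u]expRK -lnM ?posrE ?expR_gt0 ?addr_gt0 ?expR_gt0//.
by rewrite mulrDr mulr1 -expRD subrr expR0 addrC.
Qed.

Lemma is_derive_window (F f : R -> R) (c : R) (x : R) (b : R) :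
  is_derive (c + b * x) 1 F (f (c + b * x)) ->
  is_derive x 1 (fun s => F (c + b * s)) (b * f (c + b * x)).
Proof.
move=> dF; have dg : is_derive x 1 (fun s : R => c + b * s) b.
  by apply: is_derive_eq; rewrite /GRing.scale/= ; ring.
by rewrite mulrC; exact: is_derive1_comp.
Qed.

Lemma MVT_derivable (g dg : R -> R) (a b : R) : a <= b ->
  (forall u, a <= u <= b -> is_derive u 1 g (dg u)) ->
  exists2 c, a <= c <= b & g b - g a = dg c * (b - a).
Proof.
move=> ab derg; have [|||c] := @MVT_segment _ g dg a b.
- by [].
- by move=> c /subset_itv_oo_cc; rewrite in_itv; exact: derg.
- apply: continuous_in_subspaceT => c; rewrite inE/= in_itv/= => /derg[dc _].
  exact/differentiable_continuous/derivable1_diffP.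
- by rewrite in_itv; exists c.
Qed.

Lemma mean_value_bound (g dg : R -> R) (b M t : R) : `|t| <= b ->
  (forall u : R, `|u| <= b -> is_derive u 1 g (dg u)) ->
  (forall u : R, `|u| <= b -> `|dg u| <= M) ->
  `|g t - g 0| <= b * M.
Proof.
move=> tb derg dgM.
have b0 : 0 <= b by apply: le_trans tb.
have n0 : `|0 : R| <= b by rewrite normr0.
have [c cb e] : exists2 c, `|c| <= b & `|g t - g 0| = `|dg c| * `|t|.
  move: tb; rewrite ler_norml => /andP[bt tb].
  have seg u v : - b <= u -> v <= b -> u <= v ->
      exists2 c, `|c| <= b & g v - g u = dg c * (v - u).
    move=> bu vb uv; have inb c : u <= c <= v -> `|c| <= b.
      by move=> /andP[uc cv]; rewrite ler_norml (le_trans bu)//= (le_trans cv).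
    by have [c /inb] := MVT_derivable uv (fun c cuv => derg c (inb c cuv)); exists c.
  have [t0|/ltW t0] := leP 0 t.
    have [||c cb ->] := seg _ _ _ _ t0; rewrite ?oppr_le0//.
    by exists c => //; rewrite subr0 normrM.
  have [||c cb e] := seg _ _ _ _ t0 => //; exists c => //.
  by rewrite distrC e sub0r normrM normrN.
by rewrite e mulrC; apply: ler_pM => //; exact: dgM.
Qed.

(* Integrating [softplus u - softplus (- u) = u]: up to an exponentially small
   error, the integral of [softplus] over [[t - s, t + s]] is [t ^+ 2 / 2 + t * s]
   plus a term that does not depend on [t]. *)
Lemma window_bound (F : R -> R) (b s t : R)
    (r := fun t => F (t + s) - F (t - s) - t ^+ 2 / 2 - t * s) : 0 <= s -> `|t| <= b ->
  (forall u, - (b + s + 1) < u -> is_derive u 1 F (softplus u)) ->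
  let r := fun t => F (t + s) - F (t - s) - t ^+ 2 / 2 - t * s in
  `|r t - r 0| <= b * (2 * expR b * expR (- s)).
Proof.
move=> s0 tb dF.
pose dr u := softplus (u + s) - softplus (u - s) - u - s.
apply: (@mean_value_bound r dr) => // u; rewrite ler_norml => /andP[bu ub].
- have d1 : is_derive u 1 (fun v => F (s + 1 * v)) (1 * softplus (s + 1 * u)).
    by apply: is_derive_window; apply: dF; lra.
  have d2 : is_derive u 1 (fun v => F (- s + 1 * v)) (1 * softplus (- s + 1 * u)).
    by apply: is_derive_window; apply: dF; lra.
  have -> : r = fun v => F (s + 1 * v) - F (- s + 1 * v) - v ^+ 2 / 2 - v * s.
    by apply/funext => v; rewrite /r !mul1r [s + v]addrC [- s + v]addrC.
  apply: is_derive_eq; rewrite /dr !mul1r [s + u]addrC [- s + u]addrC /GRing.scale/=.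
  by field.
(* [softplusN] cancels the polynomial part and leaves two nonnegative terms, each at most
   [expR (b - s)]. *)
- have -> : dr u = softplus (- (u + s)) - softplus (u - s).
    by rewrite /dr (softplusN (u + s)); ring.
  have e1 := softplus_le_expR (- (u + s)); have e2 := softplus_le_expR (u - s).
  have p1 := softplus_ge0 (- (u + s)); have p2 := softplus_ge0 (u - s).
  rewrite -mulrA -expRD.
  have f1 : expR (- (u + s)) <= expR (b - s) by rewrite ler_expR; lra.
  have f2 : expR (u - s) <= expR (b - s) by rewrite ler_expR; lra.
  by rewrite ler_norml; apply/andP; split; lra.
Qed.

Lemma archimedean_expR (e M : R) : (forall s, 0 <= s -> e <= M * expR (- s)) -> e <= 0.
Proof.
move=> h; apply/ler_addgt0Pr => d d0; rewrite add0r.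
have [M0|M0] := leP M 0.
  apply: le_trans (h 0 (lexx _)) _; rewrite oppr0 expR0 mulr1.
  exact: le_trans M0 (ltW d0).
(* At [s = M / d] the bound [1 + s <= expR s] gives [M * expR (- s) <= d]. *)
have s0 : 0 <= M / d by rewrite ltW// divr_gt0.
apply: le_trans (h _ s0) _.
rewrite expRN ler_pdivrMr ?expR_gt0//.
have := expR_ge1Dx (M / d); rewrite -(ler_pM2l d0).
by rewrite mulrDr mulrCA divff ?gt_eqF//; lra.
Qed.

(** Integrate the hypothesis over translations in [[- s, s]]. By [window_bound] each side becomes
    half its sum of squares, plus [s] times its sum, plus a common constant, up to an error of order
    [expR (- s)]. The sums agree, so large [s] leaves only the squares. *)
Lemma sum_sqr_le (n : nat) (x y : 'I_n -> R) :
  \sum_i x i = \sum_i y i ->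
  (forall s, \sum_i softplus (x i + s) <= \sum_i softplus (y i + s)) ->
  \sum_i x i ^+ 2 <= \sum_i y i ^+ 2.
Proof.
move=> exy sxy; rewrite -subr_le0.
pose b := \sum_i `|x i| + \sum_i `|y i|.
have xb i : `|x i| <= b.
  rewrite /b (bigD1 i)//= -addrA lerDl addr_ge0// ?sumr_ge0//.
have yb i : `|y i| <= b.
  by rewrite /b addrC (bigD1 i)//= -addrA lerDl addr_ge0// ?sumr_ge0.
(* The [8] collects a [2] for the two families, a [2] for the halved squares and the [2] inside
   [B]. *)
apply: (@archimedean_expR _ (8 * n%:R * b * expR b)) => s s0.
(* All arguments of [F] below are at least [- (b + s)]; the extra [1] makes the inequality
   strict. *)
have [F dF] := continuous_antiderivative (- (b + s + 1)) continuous_softplus.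
pose r t := F (t + s) - F (t - s) - t ^+ 2 / 2 - t * s.
pose B := b * (2 * expR b * expR (- s)).
have rB t : `|t| <= b -> `|r t - r 0| <= B by move=> tb; exact: window_bound.
(* [K z] is the integral over [[- z, z]] of the difference of the two [softplus] sums. Its
   derivative, that difference at [z] plus the one at [- z], is nonnegative. *)
pose K z := \sum_i (F (y i + z) - F (y i - z)) - \sum_i (F (x i + z) - F (x i - z)).
have K0 : K 0 = 0.
  by rewrite /K !big1 ?subr0// => i _; rewrite subr0 addr0 subrr.
have Ks : 0 <= K s.
  pose h i z := F (y i + 1 * z) - F (y i + -1 * z) -
    (F (x i + 1 * z) - F (x i + -1 * z)).
  pose dh i z := 1 * softplus (y i + 1 * z) - -1 * softplus (y i + -1 * z) -
    (1 * softplus (x i + 1 * z) - -1 * softplus (x i + -1 * z)).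
  have eK : K = \sum_i h i.
    apply/funext => z; rewrite fct_sumE /K -sumrB; apply: eq_bigr => i _.
    by rewrite /h !mul1r !mulN1r.
  have dK z : 0 <= z <= s -> is_derive z 1 K (\sum_i dh i z).
    move=> /andP[z0 zs]; rewrite eK; apply: is_derive_sum => i.
    have := xb i; have := yb i; rewrite !ler_norml => /andP[? ?] /andP[? ?].
    have d1 := @is_derive_window F softplus (y i) z 1 (dF _ _).
    have d2 := @is_derive_window F softplus (y i) z (-1) (dF _ _).
    have d3 := @is_derive_window F softplus (x i) z 1 (dF _ _).
    have d4 := @is_derive_window F softplus (x i) z (-1) (dF _ _).
    apply: is_deriveB; apply: is_deriveB;
      [apply: d1|apply: d2|apply: d3|apply: d4]; lra.
  have [c _ e] := MVT_derivable s0 dK.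
  move: e; rewrite K0 !subr0 => ->; rewrite mulr_ge0//.
  have -> : \sum_i dh i c =
      (\sum_i softplus (y i + c) - \sum_i softplus (x i + c)) +
      (\sum_i softplus (y i + - c) - \sum_i softplus (x i + - c)).
    rewrite -!sumrB -big_split/=; apply: eq_bigr => i _.
    by rewrite /dh !mul1r !mulN1r; ring.
  by rewrite addr_ge0// subr_ge0.
have eKs : K s = \sum_i (r (y i) - r 0) - \sum_i (r (x i) - r 0) +
    (\sum_i y i ^+ 2 - \sum_i x i ^+ 2) / 2.
  have : K s = \sum_i ((r (y i) - r 0) - (r (x i) - r 0) +
      (y i ^+ 2 - x i ^+ 2) / 2) + (\sum_i y i - \sum_i x i) * s.
    rewrite /K -!sumrB mulr_suml -big_split/=; apply: eq_bigr => i _.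
    by rewrite /r; field.
  by rewrite exy subrr mul0r addr0 big_split/= -mulr_suml !sumrB.
have sumB (z : 'I_n -> R) : (forall i, `|z i| <= b) ->
    `|\sum_i (r (z i) - r 0)| <= n%:R * B.
  move=> zb; apply: le_trans (ler_norm_sum _ _ _) _.
  apply: le_trans (ler_sum _ (fun i _ => rB _ (zb i))) _.
  by rewrite sumr_const card_ord mulr_natl.
move: (sumB x xb) (sumB y yb) Ks; rewrite eKs !ler_norml => /andP[h1 h2] /andP[h3 h4] h5.
have -> : 8 * n%:R * b * expR b * expR (- s) = 4 * (n%:R * B) by rewrite /B; ring.
lra.
Qed.

(** This is [sum_sqr_le] for [ln (b_i / a_i)] and [ln d_i], with [t = expR s]; exponentiating turns
    its sums into products. *)
Lemma sum_sqr_ln_ratio_le (n : nat) (a b d : 'I_n -> R) :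
  (forall i, 0 < a i) -> (forall i, 0 < b i) -> (forall i, 0 < d i) ->
  \prod_i (b i / a i) = \prod_i d i ->
  (forall t, 0 < t -> \prod_i (1 + t * (b i / a i)) <= \prod_i (1 + t * d i)) ->
  \sum_i (ln (a i) - ln (b i)) ^+ 2 <= \sum_i ln (d i) ^+ 2.
Proof.
move=> a0 b0 d0 eqd led.
have -> : \sum_i (ln (a i) - ln (b i)) ^+ 2 = \sum_i ln (b i / a i) ^+ 2.
  by apply: eq_bigr => i _; rewrite ln_div ?posrE// -sqrrN opprB.
have q0 i : 0 < b i / a i by rewrite divr_gt0.
have sum_ln (z : 'I_n -> R) : (forall i, 0 < z i) ->
    expR (\sum_i ln (z i)) = \prod_i z i.
  by move=> z0; rewrite expR_sum; apply: eq_bigr => i _; rewrite lnK// posrE.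
have sum_softplus (z : 'I_n -> R) s : (forall i, 0 < z i) ->
    expR (\sum_i softplus (ln (z i) + s)) = \prod_i (1 + expR s * z i).
  move=> z0; rewrite expR_sum; apply: eq_bigr => i _.
  rewrite /softplus expRD (@lnK _ (z i)) ?posrE// [z i * _]mulrC lnK//.
  by rewrite posrE addr_gt0// mulr_gt0 ?expR_gt0.
apply: sum_sqr_le => [|s]; first by apply: expR_inj; rewrite !sum_ln.
by rewrite -ler_expR !sum_softplus// led// expR_gt0.
Qed.

End LogSumInequality.

(** * Nonexpansive maps and Wasserstein distances *)

Section PushforwardCoupling.
Local Open Scope ereal_scope.
Import HBNNSimple.

(** Only the generating open sets need testing, and the ball around [f x] pulls back to a set
    containing the ball of the same radius around [x]. *)
Lemma measurable_nonexpansive (R : realType) d1 d2 (T1 : measurableType d1)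
    (T2 : measurableType d2) (e1 : T1 -> T1 -> R) (e2 : T2 -> T2 -> R)
    (f : T1 -> T2) :
  (forall U, dist_open e1 U -> measurable U) ->
  @measurable _ T2 = <<s dist_open e2 >> ->
  (forall x y, e2 (f x) (f y) <= e1 x y)%R ->
  measurable_fun setT f.
Proof.
move=> m1 m2 nef; apply: (measurability _ m2) => _ [U oU <-].
rewrite setTI; apply: m1 => x /oU [r /= r0 rU]; exists r => //= y /= xy.
by apply: rU; exact: le_lt_trans xy.
Qed.

(* No measurability of [f] or [g]: a simple function below [f] pulls back to a
   simple function below [g]. *)
Lemma le_integral_pushforward (R : realType) d1 d2 (T1 : measurableType d1)
    (T2 : measurableType d2) (mu : {measure set T1 -> \bar R})
    (nu : {measure set T2 -> \bar R}) (phi : T1 -> T2)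
    (f : T2 -> \bar R) (g : T1 -> \bar R) :
  measurable_fun setT phi -> (forall U, measurable U -> nu U = mu (phi @^-1` U)) ->
  (forall y, 0 <= f y) -> (forall x, f (phi x) <= g x) ->
  \int[nu]_y f y <= \int[mu]_x g x.
Proof.
move=> mphi enu f0 fg.
have g0 x : 0 <= g x by exact: le_trans (fg x).
rewrite !ge0_integralTE//; apply: ge_ereal_sup => _ [h /= hf <-].
have -> : sintegral nu h = \int[mu]_x (h (phi x))%:E.
  rewrite -integralT_nnsfun.
  rewrite (@eq_measure_integral _ _ _ setT (pushforward mu phi)).
    rewrite ge0_integral_pushforward//; first exact/measurable_EFinP.
    by move=> y _; rewrite lee_fin.
  by move=> A mA _; exact: enu.
rewrite ge0_integralTE; last by move=> x; rewrite lee_fin.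
apply: ereal_sup_le => _ [k /= kh <-]; exists k => // x.
exact: le_trans (kh x) (le_trans (hf _) (fg _)).
Qed.

Lemma wasserstein_pushforward (R : realType) d1 d2 (T1 : measurableType d1)
    (T2 : measurableType d2) (e1 : T1 -> T1 -> R) (e2 : T2 -> T2 -> R)
    (f : T1 -> T2) (mu nu : set T1 -> \bar R) :
  measurable_fun setT f -> (forall y z, 0 <= e2 y z)%R ->
  (forall x y, e2 (f x) (f y) <= e1 x y)%R ->
  wasserstein e2 (pushforward mu f) (pushforward nu f) <= wasserstein e1 mu nu.
Proof.
move=> mf e20 nef; apply: le_ereal_inf_tmp => _ [pi cpi <-].
pose phi (z : T1 * T1) := (f z.1, f z.2).
have mphi : measurable_fun setT phi.
  by apply: measurable_fun_pair; exact: measurableT_comp.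
pose X : {mfun (T1 * T1)%type >-> (T2 * T2)%type} := mfun_Sub (mem_set mphi).
apply: ge_ereal_inf; exists (\int[distribution pi X]_z (e2 z.1 z.2)%:E).
  exists (distribution pi X) => // U mU.
  have mfU : measurable (f @^-1` U) by rewrite -[X in measurable X]setTI; exact: mf.
  by have [] := cpi _ mfU.
(* No hypothesis makes [e2] measurable on the product, so the costs are compared without a change of
   variables. *)
apply: (@le_integral_pushforward _ _ _ _ _ pi _ phi) => //.
  by move=> y; rewrite lee_fin; exact: e20.
by move=> x; rewrite lee_fin; exact: nef.
Qed.

End PushforwardCoupling.

(** * The trace inequality and Fiedler's determinant inequality *)

Section Fiedler.
Variable R : realType.

(** Summation by parts: with [G_k] the sum of the first [k] terms of [g], the two sides differ by
    the sum over [k < n] of [(d_k - d_(k+1)) * G_(k+1)]. *)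
Lemma abel_sum_ge (n : nat) (d g : nat -> R) :
  (forall k, (k < n)%N -> d k.+1 <= d k) ->
  (forall k, (k <= n)%N -> 0 <= \sum_(i < k) g i) ->
  d n * \sum_(i < n.+1) g i <= \sum_(i < n.+1) d i * g i.
Proof.
elim: n => [|n IHn] dd gg; first by rewrite !big_ord_recr !big_ord0/= !add0r.
rewrite [leRHS]big_ord_recr [in leLHS]big_ord_recr/= mulrDr lerD2r.
apply: le_trans (IHn _ _); first by rewrite ler_wpM2r ?gg ?dd.
- by move=> k kn; apply: dd; exact: leqW.
- by move=> k kn; apply: gg; exact: leqW.
Qed.

(** Averaging the increasing [e] by [w] keeps its total and does not lower any prefix sum;
    [abel_sum_ge] pairs this with the decreasing [d]. *)
Lemma doubly_stochastic_sum_ge (n : nat) (w : 'M[R]_n) (d e : 'I_n -> R) :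
  (forall i j, 0 <= w i j) -> (forall i, \sum_j w i j = 1) ->
  (forall j, \sum_i w i j = 1) ->
  (forall i j : 'I_n, (i <= j)%N -> d j <= d i) ->
  (forall i j : 'I_n, (i <= j)%N -> e i <= e j) ->
  \sum_i d i * e i <= \sum_i \sum_j w i j * (d i * e j).
Proof.
(* [inord], which carries the vectors to the indexing by [nat] of [abel_sum_ge], needs a nonempty
   ordinal type. *)
case: n => [|n] in w d e *; first by rewrite !big_ord0.
move=> w0 rw cw dd de; rewrite -subr_ge0.
pose g i := \sum_j w i j * e j - e i.
have -> : \sum_i \sum_j w i j * (d i * e j) - \sum_i d i * e i = \sum_i d i * g i.
  rewrite -sumrB; apply: eq_bigr => i _; rewrite /g mulrBr mulr_sumr.
  by congr (_ - _); apply: eq_bigr => j _; rewrite mulrCA.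
have sum_inord (h : 'I_n.+1 -> R) k : (k <= n.+1)%N ->
    \sum_(i < k) h (inord i) = \sum_(i < n.+1 | (i < k)%N) h i.
  move=> kn; rewrite (big_ord_widen _ (fun i => h (inord i)) kn).
  by apply: eq_bigr => i _; rewrite inord_val.
have total : \sum_i g i = 0.
  rewrite /g sumrB exchange_big/= -[X in _ - X](eq_bigr _ (fun _ _ => mul1r _)).
  by rewrite -sumrB big1// => j _; rewrite -mulr_suml cw subrr.
have prefix k : (k <= n)%N -> 0 <= \sum_(i < n.+1 | (i < k)%N) g i.
  case: k => [_|k kn]; first by rewrite big_pred0.
  pose c : 'I_n.+1 := inord k.
  have ck : c = k :> nat by rewrite inordK// ltnW.
  (* The weights [v j] lie in [[0, 1]] and total [k.+1], so they give [e] the smallest sum when they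
     fill the first [k.+1] places. *)
  pose v j := \sum_(i < n.+1 | (i < k.+1)%N) w i j.
  have v0 j : 0 <= v j by apply: sumr_ge0.
  have v1 j : v j <= 1 by rewrite -(cw j) /v big_mkcond ler_sum// => i _; case: ifP.
  have sv : \sum_j (v j - (j < k.+1)%N%:R) = 0.
    rewrite sumrB /v exchange_big/= (eq_bigr (fun=> 1)) ?big_mkcond; last first.
      by move=> i _; rewrite rw.
    by rewrite -sumrB big1// => i _; case: ifP => _; rewrite subrr.
  (* As [sv] says, shifting [e] by [e c] changes nothing, and it makes every
     term of the sum nonnegative. *)
  have -> : \sum_(i < n.+1 | (i < k.+1)%N) g i =
      \sum_j (v j - (j < k.+1)%N%:R) * (e j - e c).
    under [RHS]eq_bigr do rewrite mulrBr.
    rewrite [RHS]sumrB -mulr_suml sv mul0r subr0.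
    under [RHS]eq_bigr do rewrite mulrBl.
    rewrite /g !sumrB exchange_big/=; congr (_ - _).
      by apply: eq_bigr => j _; rewrite mulr_suml.
    rewrite big_mkcond; apply: eq_bigr => j _.
    by case: ifP; rewrite ?mul1r ?mul0r.
  apply: sumr_ge0 => j _; have [jk|kj] := ltnP j k.+1.
    by apply: mulr_le0; rewrite subr_le0// de// ck.
  by rewrite subr0 mulr_ge0// subr_ge0 de// ck ltnW.
have := @abel_sum_ge n (fun i => d (inord i)) (fun i => g (inord i)).
rewrite (sum_inord g n.+1 (leqnn _)).
have -> : \sum_(i < n.+1 | (i < n.+1)%N) g i = 0.
  by rewrite -[RHS]total; apply: eq_bigl => i; rewrite ltn_ord.
rewrite mulr0 (sum_inord (fun i => d i * g i) n.+1 (leqnn _)).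
rewrite (eq_bigl xpredT); last by move=> i; rewrite ltn_ord.
apply.
- by move=> k kn; apply: dd; rewrite !inordK// ltnW.
- by move=> k kn; rewrite sum_inord ?prefix// leqW.
Qed.

Variable n : nat.
Implicit Types U V : 'M[R]_n.

(** The trace is the sum of [W_ij ^+ 2 * (d_i * e_j)] for the orthogonal [W = U *m V^T], whose
    squared entries form a doubly stochastic matrix. *)
Lemma mxtrace_orthodiag_ge U V (d e : 'rV[R]_n) :
  U *m U^T = 1%:M -> V *m V^T = 1%:M ->
  (forall i j : 'I_n, (i <= j)%N -> d 0 j <= d 0 i) ->
  (forall i j : 'I_n, (i <= j)%N -> e 0 i <= e 0 j) ->
  \sum_i d 0 i * e 0 i <=
    \tr ((U^T *m diag_mx d *m U) *m (V^T *m diag_mx e *m V)).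
Proof.
move=> UU VV dd de; pose W := U *m V^T.
have WW : W *m W^T = 1%:M.
  by rewrite trmx_mul trmxK !mulmxA -[_ *m _ *m V]mulmxA (mulmx1C VV) mulmx1.
have -> : \tr ((U^T *m diag_mx d *m U) *m (V^T *m diag_mx e *m V)) =
    \sum_i \sum_j W i j ^+ 2 * (d 0 i * e 0 j).
  rewrite mxtrace_mulC !mulmxA mxtrace_mulC !mulmxA.
  rewrite (_ : _ *m _ = W *m diag_mx e *m W^T *m diag_mx d); last first.
    by rewrite trmx_mul trmxK !mulmxA.
  apply: eq_bigr => i _; rewrite mul_mx_diag mxE mxE mulr_suml.
  by apply: eq_bigr => j _; rewrite mul_mx_diag !mxE; ring.
have sqE i j : W i j ^+ 2 = (\matrix_(i, j) W i j ^+ 2) i j by rewrite mxE.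
under [leRHS]eq_bigr do under eq_bigr do rewrite sqE.
apply: doubly_stochastic_sum_ge => //.
- by move=> i j; rewrite mxE sqr_ge0.
- move=> i; have /matrixP/(_ i i) := WW; rewrite !mxE eqxx mulr1n => <-.
  by apply: eq_bigr => j _; rewrite !mxE expr2.
- move=> i; have /matrixP/(_ i i) := mulmx1C WW; rewrite !mxE eqxx mulr1n => <-.
  by apply: eq_bigr => j _; rewrite !mxE expr2.
Qed.

Lemma det_orthodiag U (a : 'rV[R]_n) : U *m U^T = 1%:M ->
  \det (U^T *m diag_mx a *m U) = \prod_i a 0 i.
Proof. by move=> UU; rewrite det_mulmx mulrC -det_mulmx mulmxA UU mul1mx det_diag. Qed.

Lemma fiedler_det_ge (U V W : 'M[R]_n) (a b c : 'rV[R]_n) :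
  U *m U^T = 1%:M -> V *m V^T = 1%:M -> W *m W^T = 1%:M ->
  posvec a -> posvec b -> posvec c ->
  (forall i j : 'I_n, (i <= j)%N -> a 0 j <= a 0 i) ->
  (forall i j : 'I_n, (i <= j)%N -> b 0 j <= b 0 i) ->
  (forall i j : 'I_n, (i <= j)%N -> c 0 j <= c 0 i) ->
  U^T *m diag_mx a *m U + V^T *m diag_mx b *m V = W^T *m diag_mx c *m W ->
  \prod_i (a 0 i + b 0 i) <= \prod_i c 0 i.
Proof.
move=> UU VV WW a0 b0 c0 da db dc eC.
(* The spectrum of the inverse of the sum, increasing where [a] and [b] decrease. *)
pose e : 'rV[R]_n := \row_i (c 0 i)^-1.
have de (i j : 'I_n) : (i <= j)%N -> e 0 i <= e 0 j.
  by move=> ij; rewrite !mxE lef_pV2 ?posrE ?c0// dc.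
pose q i := (a 0 i + b 0 i) / c 0 i.
have q0 i : 0 <= q i by rewrite divr_ge0 ?addr_ge0 ?ltW.
have sq : \sum_i q i <= n%:R.
  have trC : \tr ((W^T *m diag_mx c *m W) *m (W^T *m diag_mx e *m W)) = n%:R.
    rewrite !mulmxA -[_ *m W *m _]mulmxA WW mulmx1 -[_ *m diag_mx c *m _]mulmxA.
    have -> : diag_mx c *m diag_mx e = 1%:M.
      apply/matrixP => i j; rewrite mul_diag_mx !mxE.
      have [->|] := eqVneq i j; last by rewrite mulr0n mulr0.
      by rewrite mulr1n divff// gt_eqF// c0.
    by rewrite mulmx1 (mulmx1C WW) mxtrace1.
  rewrite -trC -eC mulmxDl mxtraceD.
  apply: le_trans (lerD (mxtrace_orthodiag_ge UU WW da de)
    (mxtrace_orthodiag_ge VV WW db de)).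
  by rewrite -big_split/= ler_sum// => i _; rewrite !mxE -mulrDl.
have [AGM _] := @leif_AGM R 'I_n predT q (fun i _ => q0 i).
have : \prod_i q i <= 1.
  apply: le_trans AGM _; rewrite exprn_ile1//.
    by rewrite divr_ge0 ?sumr_ge0.
  (* For [n = 0] the mean is [0], by the convention that the inverse of [0] is [0]. *)
  have [->|n0] := posnP #|'I_n|; first by rewrite invr0 mulr0.
  by rewrite ler_pdivrMr ?ltr0n// mul1r card_ord.
by rewrite /q prodf_div ler_pdivrMr ?mul1r// prodr_gt0.
Qed.

End Fiedler.

(** * Contractivity of the eigenvalue map *)

Section EigenvalueContraction.
Variables (R : realType) (n : nat).

(** One spectrum [d], that of the positive definite [S *m val B *m S], yields both the distance and
    the determinants, as [sum_sqr_ln_ratio_le] requires. *)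
Lemma deltaE (A B : Pn R n) (S := mxpow (- 2^-1) (val A)) :
  exists d : 'rV[R]_n, [/\ posvec d,
    delta A B = Num.sqrt (\sum_i ln (d 0 i) ^+ 2),
    \det (S *m val B *m S) = \prod_i d 0 i &
    forall t, \det (1%:M + t *: (S *m val B *m S)) = \prod_i (1 + t * d 0 i)].
Proof.
have posA := set_mem (valP A); have posB := set_mem (valP B).
have SAS : S *m val A *m S = 1%:M := mulmx_invsqrt posA.
have symS : S^T = S by apply: mxfun_tr; exact: posA.1.
have Su : S \in unitmx by have [] := mulmx1_unit SAS.
pose C := S *m val B *m S.
have posC : posdefmx C.
  split=> [|u u0]; first by rewrite !trmx_mul symS posB.1 mulmxA.
  have := posB.2 (u *m S); rewrite trmx_mul symS !mulmxA; apply.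
  apply: contra_neq u0 => /(congr1 (mulmx^~ (invmx S))).
  by rewrite -mulmxA mulmxV// mulmx1 mul0mx.
have [U [d [UU eC d0 _]]] := posdef_orthodiag posC.
have Uu : U \in unitmx by have [] := mulmx1_unit UU.
have invU : invmx U = U^T by rewrite -[LHS]mulmx1 -UU mulKmx.
exists d; split=> //.
- rewrite /delta -/S -/C eC -invU /mxlog mxfun_diag// /norm2; congr Num.sqrt.
  rewrite invU mxtrace_mulC !mulmxA -[_ *m U *m U^T]mulmxA UU mulmx1.
  rewrite mxtrace_mulC !mulmxA UU mul1mx.
  by apply: eq_bigr => i _; rewrite mul_mx_diag !mxE eqxx mulr1n expr2.
- by rewrite -/C eC det_orthodiag.
- move=> t; rewrite -/C eC.
  have -> : 1%:M + t *: (U^T *m diag_mx d *m U) =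
      U^T *m diag_mx (\row_i (1 + t * d 0 i)) *m U.
    have -> : diag_mx (\row_i (1 + t * d 0 i)) = 1%:M + t *: diag_mx d.
      by apply/matrixP => i j; rewrite !mxE mulrnDl mulrnAr.
    by rewrite mulmxDr mulmxDl mulmx1 (mulmx1C UU) -scalemxAr -scalemxAl.
  by rewrite det_orthodiag//; apply: eq_bigr => i _; rewrite mxE.
Qed.

Lemma det_lambda (A : Pn R n) : \det (val A) = \prod_i val (lambda A) 0 i.
Proof. by have [U UU {1}->] := lambda_orthodiag A; rewrite det_orthodiag. Qed.

(** As [S *m val A *m S] is the identity, the right side is the determinant of
    [S *m (val A + t *: val B) *m S]. What remains is Fiedler's inequality for [val A] and
    [t *: val B], multiplied by [\det S ^+ 2], the inverse of [\det (val A)]. *)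
Lemma prod_ratio_le (A B : Pn R n) (S := mxpow (- 2^-1) (val A)) (t : R) :
  0 < t ->
  \prod_i (1 + t * (val (lambda B) 0 i / val (lambda A) 0 i)) <=
  \det (1%:M + t *: (S *m val B *m S)).
Proof.
move=> t0; have posA := set_mem (valP A); have posB := set_mem (valP B).
have a0 := set_mem (valP (lambda A)); have b0 := set_mem (valP (lambda B)).
have [sa _] := lambdaP A; have [sb _] := lambdaP B.
have [U UU eA] := lambda_orthodiag A; have [V VV eB] := lambda_orthodiag B.
set a := val (lambda A) in a0 sa eA *; set b := val (lambda B) in b0 sb eB *.
have SAS : S *m val A *m S = 1%:M := mulmx_invsqrt posA.
have posC : posdefmx (val A + t *: val B).
  split=> [|u u0]; first by rewrite linearD linearZ/= posA.1 posB.1.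
  rewrite mulmxDr mulmxDl -scalemxAr -scalemxAl !mxE.
  have := posA.2 u u0; have := posB.2 u u0; rewrite !mxE => hB hA.
  by rewrite addr_gt0// mulr_gt0.
have [W [c [WW eC c0 sc]]] := posdef_orthodiag posC.
have tb0 : posvec (t *: b) by move=> i; rewrite mxE mulr_gt0.
have stb (i j : 'I_n) : (i <= j)%N -> (t *: b) 0 j <= (t *: b) 0 i.
  by move=> ij; rewrite !mxE ler_pM2l// sb.
have etb : V^T *m diag_mx (t *: b) *m V = t *: val B.
  by rewrite eB [diag_mx _]linearZ/= -scalemxAr -scalemxAl.
have := @fiedler_det_ge R n U V W a (t *: b) c UU VV WW a0 tb0 c0 sa stb sc.
rewrite etb -eA -eC -(det_orthodiag c WW) -eC => /(_ erefl) fied.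
have detS : \det S ^+ 2 * \prod_i a 0 i = 1.
  rewrite -det_lambda.
  by have := congr1 determinant SAS; rewrite !det_mulmx det1 => <-; ring.
have -> : 1%:M + t *: (S *m val B *m S) = S *m (val A + t *: val B) *m S.
  by rewrite mulmxDr mulmxDl SAS -scalemxAr -scalemxAl.
rewrite !det_mulmx mulrAC -expr2.
have -> : \prod_i (1 + t * (b 0 i / a 0 i)) =
    \det S ^+ 2 * \prod_i (a 0 i + (t *: b) 0 i).
  have pa : \prod_i a 0 i != 0 by apply/prodf_neq0 => i _; rewrite gt_eqF.
  apply: (mulfI pa); rewrite mulrA [_ * \det S ^+ 2]mulrC detS mul1r -big_split/=.
  apply: eq_bigr => i _; rewrite mxE mulrDr mulr1 mulrCA.
  by rewrite [a 0 i * _]mulrCA divff ?mulr1// gt_eqF.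
by rewrite ler_wpM2l// sqr_ge0.
Qed.

(** Both sides are [\det (val B) / \det (val A)]. *)
Lemma prod_ratio_eq (A B : Pn R n) (S := mxpow (- 2^-1) (val A)) :
  \prod_i (val (lambda B) 0 i / val (lambda A) 0 i) = \det (S *m val B *m S).
Proof.
have SAS : S *m val A *m S = 1%:M := mulmx_invsqrt (set_mem (valP A)).
have a0 := set_mem (valP (lambda A)).
have pa : \det (val A) != 0.
  by rewrite det_lambda; apply/prodf_neq0 => i _; rewrite gt_eqF.
have := congr1 determinant SAS.
rewrite prodf_div -!det_lambda !det_mulmx det1 => detS.
by apply: (mulIf pa); rewrite divfK// -[LHS]mulr1 -detS; ring.
Qed.

Lemma lambda_contractive (A B : Pn R n) :
  deltapos (lambda A) (lambda B) <= delta A B.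
Proof.
have [d [d0 -> detC detCt]] := deltaE A B.
rewrite ler_wsqrtr//; apply: sum_sqr_ln_ratio_le => //.
- exact: set_mem (valP (lambda A)).
- exact: set_mem (valP (lambda B)).
- by rewrite prod_ratio_eq.
- by move=> t t0; rewrite -detCt prod_ratio_le.
Qed.

(** Continuity of the eigenvalues, hence measurability, comes from the contraction itself. *)
Lemma measurable_lambda : measurable_fun setT (@lambda R n).
Proof.
apply: (@measurable_nonexpansive R _ _ _ _ (@delta R n) (@deltapos R n)) => //.
  by move=> U oU; exact: sub_sigma_algebra.
exact: lambda_contractive.
Qed.

End EigenvalueContraction.

Theorem proposition2p4 (R : realType) (n : nat) :
  (forall A B : Pn R n, deltapos (lambda A) (lambda B) <= delta A B) /\
  (forall mu nu : probability (Pn R n) R,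
     finite_moment (@delta R n) mu -> finite_moment (@delta R n) nu ->
     (wasserstein (@deltapos R n)
        (pushforward mu (@lambda R n)) (pushforward nu (@lambda R n))
      <= wasserstein (@delta R n) mu nu)%E).
Proof.
split=> [|mu nu _ _]; first exact: lambda_contractive.
apply: wasserstein_pushforward.
- exact: measurable_lambda.
- by move=> y z; exact: sqrtr_ge0.
- exact: lambda_contractive.
Qed.
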